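(* Let $TM=D\oplus D^{\bot}$ with $\dim D=n\geq 3$, and let $M$ be a Riemannian manifold of constant sectional curvature $c$ endowed with the semi-symmetric non-metric connection $\widehat{\nabla}$. Then for every $2$-plane $\Pi\subset D$ (at any point of $M$), \begin{align*} \widehat{\tau}^D-\widehat{K}^D(\Pi)&\leq \frac{(n+1)(n-2)}{2}c-\frac{n-1}{2}\lambda_1-\frac{n(n-1)}{2}\omega(H)+\frac{1}{2}\mathrm{tr}(\alpha_1|_{\Pi})+\frac{1}{2}\omega(\mathrm{tr}(B|_{\Pi}))\\ &\quad+A^D+\Omega^{\Pi*}+\frac{n^2(n-2)}{2(n-1)}\|H\|^2+\frac{1}{2}\|B\|^2. \end{align*}
   Context: $(M,g)$ is a smooth Riemannian manifold with Levi-Civita connection $\nabla$. $D\subseteq TM$ is a smooth subbundle (distribution) of constant rank $n$ that is non integrable, i.e. there are $X,Y\in\Gamma(D)$ with $[X,Y]\notin\Gamma(D)$. $D^\bot$ is its orthogonal complement, $\pi^D:TM\to D$ and $\pi^{D^\bot}:TM\to D^\bot$ are the orthogonal projections, $[X,Y]^D=\pi^D[X,Y]$, $[X,Y]^{D^\bot}=\pi^{D^\bot}[X,Y]$. For $X,Y\in\Gamma(D)$, $B(X,Y)=\pi^{D^\bot}(\nabla_XY)$. $U$ is a vector field on $M$, $\omega(V)=g(U,V)$. The semi-symmetric non-metric connection on $M$ is $\widehat\nabla_XY=\nabla_XY+\omega(Y)X$. For $X,Y\in\Gamma(D)$ put $\widehat\nabla^D_XY=\pi^D(\widehat\nabla_XY)$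 and $$\widehat R^D(X,Y)Z=\widehat\nabla^D_X\widehat\nabla^D_YZ-\widehat\nabla^D_Y\widehat\nabla^D_XZ-\widehat\nabla^D_{[X,Y]^D}Z-\pi^D[[X,Y]^{D^\bot},Z],$$ with $\widehat R^D(X,Y,Z,W)=g(\widehat R^D(X,Y)Z,W)$. Let $\{E_1,\dots,E_n\}$ be a local orthonormal frame of $D$, chosen (when $\Pi$ occurs) so that $E_1,E_2$ is an orthonormal basis of $\Pi$ at the point considered. Define $\widehat K^D(\Pi)=\frac12[\widehat R^D(E_1,E_2,E_2,E_1)-\widehat R^D(E_1,E_2,E_1,E_2)]$; $\widehat\tau^D=\frac12\sum_{1\le i,j\le n}\widehat R^D(E_i,E_j,E_j,E_i)$; $H=\frac1n\sum_{i=1}^nB(E_i,E_i)$; $\|B\|^2=\sum_{i,j=1}^n g(B(E_i,E_j),B(E_i,E_j))$; $\alpha_1(X,Y)=(\nabla_X\omega)(Y)-\omega(X)\omega(Y)$; $\lambda_1=\sum_{j=1}^n\alpha_1(E_j,E_j)$; $\mathrm{tr}(\alpha_1|_\Pi)=\alpha_1(E_1,E_1)+\alpha_1(E_2,E_2)$; $\mathrm{tr}(B|_\Pi)=B(E_1,E_1)+B(E_2,E_2)$; $A^D=\frac12\sum_{1\le i,j\le n}g(B(E_j,E_i),[E_j,E_i])$; $\Omega^{\Pi*}=-\frac12 g(B(E_1,E_2)-B(E_2,E_1),[E_1,E_2])$. *)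

(* Defs.v *)
From HB Require Import structures.
From mathcomp Require Import all_boot all_order all_algebra.
From mathcomp Require Import all_classical all_reals all_analysis.
Set Implicit Arguments.
Unset Strict Implicit.
Unset Printing Implicit Defensive.
Import Order.TTheory GRing.Theory Num.Theory.
Import numFieldNormedType.Exports.
Local Open Scope classical_set_scope.
Local Open Scope ring_scope.

(* Functions are total; O is an open subset of R^m and only the values on O
   matter. *)

Fixpoint Ck (R : realType) (m k : nat) (O : set 'rV[R]_m)
    (f : 'rV[R]_m -> R) : Prop :=
  (forall x, O x -> {for x, continuous f}) /\
  match k with
  | 0%N => True
  | k'.+1 => forall i : 'I_m,
      (forall x, O x -> derivable f x (delta_mx 0 i)) /\
      Ck k' O (fun x => 'D_(delta_mx 0 i) f x)
  end.

Definition Cinf (R : realType) (m : nat) (O : set 'rV[R]_m)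
    (f : 'rV[R]_m -> R) : Prop := forall k, Ck k O f.

(* The fields chart_map and chart_inv are total functions; they carry
   information only on chart_dom and on its image. *)

Record chart (R : realType) (m : nat) (M : topologicalType) := Chart {
  chart_dom : set M;
  chart_map : M -> 'rV[R]_m;
  chart_inv : 'rV[R]_m -> M;
  chart_dom_open : open chart_dom;
  chart_img_open : open (chart_map @` chart_dom);
  chart_mapK : forall p, chart_dom p -> chart_inv (chart_map p) = p;
  chart_map_cont : forall p, chart_dom p -> {for p, continuous chart_map};
  chart_inv_cont : forall x, (chart_map @` chart_dom) x ->
    {for x, continuous chart_inv} }.

Definition compatible (R : realType) (m : nat) (M : topologicalType)
    (a b : chart R m M) : Prop :=
  forall j : 'I_m, Cinf (chart_map a @` (chart_dom a `&` chart_dom b))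
    (fun x => chart_map b (chart_inv a x) 0 j).

Record smoothManifold (R : realType) (m : nat) := SmoothManifold {
  carrier :> topologicalType;
  atlas : set (chart R m carrier);
  atlas_cover : forall p : carrier, exists2 a, atlas a & chart_dom a p;
  atlas_compat : forall a b, atlas a -> atlas b -> compatible a b;
  manifold_hausdorff : hausdorff_space carrier;
  manifold_second_countable : @second_countable carrier }.

Section Tangent.
Variables (R : realType) (m : nat) (M : smoothManifold R m).

Definition smooth_on (O : set M) (f : M -> R) : Prop :=
  forall a, atlas a ->
    Cinf (chart_map a @` (chart_dom a `&` O)) (f \o chart_inv a).

Definition smooth_near (p : M) (f : M -> R) : Prop :=
  exists O : set M, [/\ open O, O p & smooth_on O f].

(* Tangent vectors at p are the derivations at p of the functions smooth near
   p.  They are set to 0 on all other functions, so that two of them are equal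
   as soon as they agree on the functions smooth near p.  The Leibniz rule,
   applied with a 0/1-valued function that is constant near p, shows that they
   only depend on the germ at p of their argument. *)
Definition is_derivation (p : M) (v : (M -> R) -> R^o) : Prop :=
  [/\ forall f, ~ smooth_near p f -> v f = 0,
      forall (a : R) f h, smooth_near p f -> smooth_near p h ->
        v (fun q => a * f q + h q) = a * v f + v h &
      forall f h, smooth_near p f -> smooth_near p h ->
        v (fun q => f q * h q) = f p * v h + h p * v f].

Definition derivation (p : M) : {pred ((M -> R) -> R^o)} :=
  fun v => `[< is_derivation p v >].

Lemma derivation_submod (p : M) : submod_closed (derivation p).
Proof.
split=> [|a u v /asboolP[u0 uD uM] /asboolP[v0 vD vM]]; apply/asboolP; split.
- by [].
- by move=> a f h _ _ /=; rewrite [LHS]/0%R /= mulr0 addr0.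
- by move=> f h _ _; rewrite !mulr0 addr0.
- move=> f nf; change (a * u f + v f = 0).
  by rewrite u0 // v0 // mulr0 addr0.
- move=> b f h sf sh.
  change (a * u (fun q => b * f q + h q) + v (fun q => b * f q + h q)
    = b * (a * u f + v f) + (a * u h + v h)).
  by rewrite uD // vD // !mulrDr mulrCA addrACA.
- move=> f h sf sh.
  change (a * u (fun q => f q * h q) + v (fun q => f q * h q)
    = f p * (a * u h + v h) + h p * (a * u f + v f)).
  rewrite uM // vM // !mulrDr -!addrA [a * (f p * _)]mulrCA.
  by rewrite [a * (h p * _)]mulrCA [h p * (a * _) + _]addrCA [RHS]addrCA
     [LHS]addrCA !addrA; congr (_ + _); rewrite addrC addrA addrAC [RHS]addrC
     addrA.
Qed.
HB.instance Definition _ (p : M) :=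
  GRing.isSubmodClosed.Build R ((M -> R) -> R^o) (derivation p)
    (derivation_submod p).

Record tangent (p : M) := Tangent {
  tangent_fun :> (M -> R) -> R^o;
  tangent_funP : tangent_fun \in derivation p }.
HB.instance Definition _ p := [isSub for @tangent_fun p].
HB.instance Definition _ p := [Choice of tangent p by <:].
HB.instance Definition _ p := [SubChoice_isSubLmodule of tangent p by <:].

(* Vector fields are total sections of TM, without smoothness requirement;
   a vector field on an open set O is represented by any section that extends
   it.  Smoothness on O is a separate predicate. *)
Definition vfield := forall p : M, tangent p.

Definition smooth_vfield (O : set M) (X : vfield) : Prop :=
  forall (V : set M) (f : M -> R), open V -> V `<=` O -> smooth_on V f ->
    smooth_on V (fun p => X p f).

(* [X, Y] at p is the derivation f |-> X(Y f) - Y(X f), whenever the latter is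
   one, which is the case if X and Y are smooth near p. *)
Definition lie (X Y : vfield) : vfield := fun p =>
  insubd (0 : tangent p) (fun f : M -> R =>
    if `[< smooth_near p f >]
    then X p (fun q => Y q f) - Y p (fun q => X q f) else 0).

Record riemannianMetric := RiemannianMetric {
  rmetric :> forall p : M, tangent p -> tangent p -> R;
  rmetric_sym : forall p (u v : tangent p), rmetric u v = rmetric v u;
  rmetric_linear : forall p (a : R) (u v w : tangent p),
    rmetric (a *: u + v) w = a * rmetric u w + rmetric v w;
  rmetric_pos : forall p (v : tangent p), v != 0 -> 0 < rmetric v v;
  rmetric_smooth : forall (O : set M) (X Y : vfield), open O ->
    smooth_vfield O X -> smooth_vfield O Y ->
    smooth_on O (fun p => rmetric (X p) (Y p)) }.

(* An affine connection, acting on the vector fields over every open set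
   (every connection on global vector fields extends uniquely to these). *)
Definition is_connection (nabla : vfield -> vfield -> vfield) : Prop :=
  forall O : set M, open O ->
  [/\ forall X Y, smooth_vfield O X -> smooth_vfield O Y ->
        smooth_vfield O (nabla X Y),
      forall f X X' Y, smooth_on O f -> smooth_vfield O X ->
        smooth_vfield O X' -> smooth_vfield O Y -> forall p, O p ->
        nabla (fun q => f q *: X q + X' q) Y p
          = f p *: nabla X Y p + nabla X' Y p,
      forall X Y Y', smooth_vfield O X -> smooth_vfield O Y ->
        smooth_vfield O Y' -> forall p, O p ->
        nabla X (fun q => Y q + Y' q) p = nabla X Y p + nabla X Y' p &
      forall f X Y, smooth_on O f -> smooth_vfield O X ->
        smooth_vfield O Y -> forall p, O p ->
        nabla X (fun q => f q *: Y q) p = X p f *: Y p + f p *: nabla X Y p].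

Definition torsion_free (nabla : vfield -> vfield -> vfield) : Prop :=
  forall (O : set M) X Y, open O -> smooth_vfield O X -> smooth_vfield O Y ->
    forall p, O p -> nabla X Y p - nabla Y X p = lie X Y p.

Definition metric_compatible (g : riemannianMetric)
    (nabla : vfield -> vfield -> vfield) : Prop :=
  forall (O : set M) X Y Z, open O -> smooth_vfield O X ->
    smooth_vfield O Y -> smooth_vfield O Z -> forall p, O p ->
    X p (fun q => g q (Y q) (Z q))
      = g p (nabla X Y p) (Z p) + g p (Y p) (nabla X Z p).

Definition levi_civita (g : riemannianMetric)
    (nabla : vfield -> vfield -> vfield) : Prop :=
  [/\ is_connection nabla, torsion_free nabla & metric_compatible g nabla].

Definition curvature (nabla : vfield -> vfield -> vfield)
    (X Y Z : vfield) : vfield := fun p =>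
  nabla X (nabla Y Z) p - nabla Y (nabla X Z) p - nabla (lie X Y) Z p.

Definition sectional_curvature (g : riemannianMetric)
    (nabla : vfield -> vfield -> vfield) (X Y : vfield) (p : M) : R :=
  g p (curvature nabla X Y Y p) (X p)
    / (g p (X p) (X p) * g p (Y p) (Y p) - g p (X p) (Y p) ^+ 2).

(* v is a basis of the linear subspace S. *)
Definition is_basis (V : lmodType R) (k : nat) (v : 'I_k -> V) (S : set V) :
    Prop :=
  (forall a : 'I_k -> R, \sum_(i < k) a i *: v i = 0 -> forall i, a i = 0) /\
  S = [set w | exists a : 'I_k -> R, w = \sum_(i < k) a i *: v i].

Definition is_plane (V : lmodType R) (S : set V) : Prop :=
  exists v : 'I_2 -> V, is_basis v S.

Definition constant_sectional_curvature (g : riemannianMetric)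
    (nabla : vfield -> vfield -> vfield) (c : R) : Prop :=
  forall (O : set M) (X Y : vfield), open O -> smooth_vfield O X ->
    smooth_vfield O Y -> forall p, O p ->
    (forall a b : R, a *: X p + b *: Y p = 0 -> a = 0 /\ b = 0) ->
    sectional_curvature g nabla X Y p = c.

Definition tangentDistribution := forall p : M, set (tangent p).

Definition local_frame (k : nat) (D : tangentDistribution) (O : set M)
    (F : 'I_k -> vfield) : Prop :=
  (forall i, smooth_vfield O (F i)) /\
  (forall q, O q -> is_basis (fun i => F i q) (D q)).

Definition smooth_subbundle (k : nat) (D : tangentDistribution) : Prop :=
  forall p : M, exists (O : set M) (F : 'I_k -> vfield),
    [/\ open O, O p & local_frame D O F].

Definition Gamma (D : tangentDistribution) (X : vfield) : Prop :=
  smooth_vfield setT X /\ forall p, D p (X p).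

Definition non_integrable (D : tangentDistribution) : Prop :=
  exists X Y, [/\ Gamma D X, Gamma D Y & ~ Gamma D (lie X Y)].

Definition orthonormal_frame (g : riemannianMetric) (k : nat)
    (D : tangentDistribution) (O : set M) (E : 'I_k -> vfield) : Prop :=
  local_frame D O E /\
  forall q, O q -> forall i j, g q (E i q) (E j q) = (i == j)%:R.

End Tangent.

Arguments rmetric {R m M} _ p _ _.

Section Connections.
Variables (R : realType) (m : nat) (M : smoothManifold R m).
Variables (g : riemannianMetric M) (nabla : vfield M -> vfield M -> vfield M).
Variables (D : tangentDistribution M) (U : vfield M).

Definition perp (S : tangentDistribution M) :
    tangentDistribution M := fun p =>
  [set v | forall u, S p u -> g p v u = 0].

(* Orthogonal projection onto S: the w in S with v - w
   orthogonal to S. *)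
Definition proj (S : tangentDistribution M) (X : vfield M) :
    vfield M := fun p =>
  xget 0 [set w | S p w /\ forall u, S p u -> g p (X p - w) u = 0].

Definition piD : vfield M -> vfield M := proj D.
Definition piDperp : vfield M -> vfield M := proj (perp D).

Definition Bform (X Y : vfield M) : vfield M := piDperp (nabla X Y).

Definition omega (p : M) (v : tangent p) : R := g p (U p) v.

Definition nabla_hat (X Y : vfield M) : vfield M := fun p =>
  nabla X Y p + omega (Y p) *: X p.

Definition nabla_hatD (X Y : vfield M) : vfield M := piD (nabla_hat X Y).

Definition R_hatD (X Y Z : vfield M) : vfield M := fun p =>
  nabla_hatD X (nabla_hatD Y Z) p - nabla_hatD Y (nabla_hatD X Z) p
  - nabla_hatD (piD (lie X Y)) Z p
  - piD (lie (piDperp (lie X Y)) Z) p.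

Definition R4_hatD (X Y Z W : vfield M) (p : M) : R :=
  g p (R_hatD X Y Z p) (W p).

Definition nabla_omega (X Y : vfield M) (p : M) : R :=
  X p (fun q => omega (Y q)) - omega (nabla X Y p).

Definition alpha1 (X Y : vfield M) (p : M) : R :=
  nabla_omega X Y p - omega (X p) * omega (Y p).

Section Frame.
Variables (n : nat) (E : 'I_n -> vfield M).

Definition tau_hatD (p : M) : R :=
  2^-1 * \sum_(i < n) \sum_(j < n) R4_hatD (E i) (E j) (E j) (E i) p.

Definition Hvec (p : M) : tangent p :=
  n%:R^-1 *: \sum_(i < n) Bform (E i) (E i) p.

Definition normB2 (p : M) : R :=
  \sum_(i < n) \sum_(j < n)
    g p (Bform (E i) (E j) p) (Bform (E i) (E j) p).

Definition lambda1 (p : M) : R := \sum_(j < n) alpha1 (E j) (E j) p.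

Definition AD (p : M) : R :=
  2^-1 * \sum_(i < n) \sum_(j < n)
    g p (Bform (E j) (E i) p) (lie (E j) (E i) p).

End Frame.

(* E1 and E2 are the members of a local orthonormal frame of D whose values at
   p form an orthonormal basis of the plane Pi. *)

Definition K_hatD (E1 E2 : vfield M) (p : M) : R :=
  2^-1 * (R4_hatD E1 E2 E2 E1 p - R4_hatD E1 E2 E1 E2 p).

Definition tr_alpha1 (E1 E2 : vfield M) (p : M) : R :=
  alpha1 E1 E1 p + alpha1 E2 E2 p.

Definition tr_B (E1 E2 : vfield M) (p : M) : tangent p :=
  Bform E1 E1 p + Bform E2 E2 p.

Definition OmegaPi (E1 E2 : vfield M) (p : M) : R :=
  - (2^-1 * g p (Bform E1 E2 p - Bform E2 E1 p) (lie E1 E2 p)).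

End Connections.

(* Main.v *)
Require Import Defs.
From mathcomp Require Import all_boot all_order all_algebra.
From mathcomp Require Import all_classical all_reals all_analysis.
From mathcomp Require Import ring lra.
Import Order.TTheory GRing.Theory Num.Theory.
Import numFieldNormedType.Exports.
Local Open Scope classical_set_scope.
Local Open Scope ring_scope.

(** The inequality is a Gauss equation, summed over the frame, followed by an
    inequality between finitely many vectors of an inner product space.

    Write [b i j] for [B(E_i, E_j)] and [A(X, Z)] for
    [alpha1(X, Z) + omega(B(X, Z))], which is [alpha1] computed with the
    induced connection [pi^D o nabla].  Splitting each covariant derivative
    into its [D] and its normal part, and moving the derivatives of normal
    fields to the other factor of the metric, gives ([gauss_hat])

      R^D(X,Y,Z,W) = R(X,Y,Z,W) + <B(Y,Z), B(X,W)> - <B(X,Z), B(Y,W)>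
         - <B(Z,W), B(X,Y) - B(Y,X)> + A(X,Z) <Y,W> - A(Y,Z) <X,W>,

    where the term in [B(Z,W)] measures the failure of [D] to be integrable.
    On an orthonormal frame only the components [R(E_i,E_j,E_j,E_i)] and
    [R(E_i,E_j,E_i,E_j)] occur; they are [c] and [-c], directly by the
    hypothesis on sectional curvatures and by the skew symmetry of [R] in its
    first two arguments.  Hence [tau] and [K] are explicit ([tau_frame],
    [K_frame]), and all terms in [c], [alpha1], [omega] and the brackets in
    [tau - K] match those of the bound.  What remains is [chen_inequality],

      |sum_i b i i|^2 / (2 (n - 1))
        <= 1/2 sum |b i j|^2 + 1/2 sum <b i j, b j i>
           + <b 1 1, b 2 2> - <b 1 2, b 2 1>.

    It is the sum of two facts.  Cauchy-Schwarz for the [n - 1] vectors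
    [b 1 1 + b 2 2, b 3 3, ..., b n n], whose sum is the trace, bounds the left
    side by [1/2 sum |b i i|^2 + <b 1 1, b 2 2>] ([chen_trace]).  The first two
    sums on the right are [1/4 sum |b i j + b j i|^2], whose diagonal and
    [(1,2)], [(2,1)] terms dominate [1/2 sum |b i i|^2 + <b 1 2, b 2 1>]
    ([symmetric_part_bound]).

    The frame lives on an open set [O] only, while vector fields and the
    connection are total.  So every identity is first turned into one on [O]:
    tangent vectors kill functions that are constant near the point, and
    connections are local operators.  Both follow from the Leibniz rule applied
    to the indicator of the complement of [O], which is smooth on [O]. *)

Set Implicit Arguments.
Unset Strict Implicit.

(** * Smooth functions on open sets *)

Section Ck.
Variables (R : realType) (m : nat).
Implicit Types (O V : set 'rV[R]_m) (f h : 'rV[R]_m -> R).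

Lemma eq_on_near O f h x : open O -> O x -> (forall y, O y -> f y = h y) ->
  \forall y \near x, f y = h y.
Proof.
by move=> oO Ox fh; near=> y; apply: fh; near: y; exact: open_nbhs_nbhs.
Unshelve. all: by end_near. Qed.

Lemma continuous_eq_near f h x : (\forall y \near x, f y = h y) ->
  {for x, continuous f} -> {for x, continuous h}.
Proof.
move=> fh cf; have cfx : f y @[y --> x] --> f x := cf.
rewrite /prop_for /= /continuous_at -(nbhs_singleton fh).
by apply: cvg_trans cfx; exact: (near_eq_cvg (F := nbhs x) fh).
Qed.

Lemma Ck_eq k O f h : open O -> (forall x, O x -> f x = h x) ->
  Ck k O f -> Ck k O h.
Proof.
elim: k f h => [|k IH] f h oO fh [cf df];
  (have ch x : O x -> {for x, continuous h}
     by move=> Ox; apply: continuous_eq_near (cf x Ox); exact: eq_on_near fh);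
  split=> //.
move=> i; have [dfi ki] := df i; split.
  by move=> x Ox; exact: near_eq_derivable (eq_on_near oO Ox fh) (dfi x Ox).
by apply: IH ki => // x Ox; apply: near_eq_derive; apply: eq_on_near fh.
Qed.

Lemma Ck_sub k O V f : V `<=` O -> Ck k O f -> Ck k V f.
Proof.
elim: k f => [|k IH] f VO [cf df]; split=> //; try by move=> x /VO; exact: cf.
move=> i; have [dfi ki] := df i; split=> [x /VO Ox|]; last exact: IH.
exact: dfi x Ox.
Qed.

Lemma Ck_weaken k O f : Ck k.+1 O f -> Ck k O f.
Proof.
elim: k f => [|k IH] f [cf df]; split=> // i.
by have [dfi ki] := df i; split=> //; exact: IH.
Qed.

Lemma Ck_cst k O (a : R) : Ck k O (fun=> a).
Proof.
elim: k a => [|k IH] a; split=> //; try by move=> x _; exact: cst_continuous.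
move=> i; split; first by move=> x _; exact: (derivable_cst a x).
rewrite [X in Ck k O X](_ : _ = fun=> 0); first exact: IH.
by apply/funext => x; exact: derive_cst.
Qed.

Lemma CkD k O f h : open O -> Ck k O f -> Ck k O h ->
  Ck k O (fun x => f x + h x).
Proof.
move=> oO; elim: k f h => [|k IH] f h [cf df] [ch dh]; split=> //;
  try by move=> x Ox; apply: continuousD; [exact: cf|exact: ch].
move=> i; have [dfi fk] := df i; have [dhi hk] := dh i; split.
  by move=> x Ox; apply: derivableD; [exact: dfi x Ox|exact: dhi x Ox].
apply: Ck_eq (IH _ _ fk hk) => // x Ox.
by rewrite -(deriveD (dfi x Ox) (dhi x Ox)).
Qed.

(** The derivative of a product involves the factors themselves, which are only
    known to be one degree smoother than the induction asks for: hence
    [Ck_weaken]. *)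
Lemma CkM k O f h : open O -> Ck k O f -> Ck k O h ->
  Ck k O (fun x => f x * h x).
Proof.
move=> oO; elim: k f h => [|k IH] f h Cf Ch; split=> //;
  try by move=> x Ox; apply: continuousM; [exact: Cf.1|exact: Ch.1].
have f1 := Ck_weaken Cf; have h1 := Ck_weaken Ch.
move=> i; have [dfi fk] := Cf.2 i; have [dhi hk] := Ch.2 i; split.
  by move=> x Ox; apply: derivableM; [exact: dfi x Ox|exact: dhi x Ox].
apply: Ck_eq (CkD oO (IH _ _ f1 hk) (IH _ _ h1 fk)) => // x Ox.
by rewrite (deriveM (dfi x Ox) (dhi x Ox)).
Qed.

End Ck.

Section Smooth.
Variables (R : realType) (m : nat) (M : smoothManifold R m).
Implicit Types (O V : set M) (f h : M -> R) (p : M) (X Y : vfield M).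

Lemma chart_img_open_sub (a : chart R m M) O : open O ->
  open (chart_map a @` (chart_dom a `&` O)).
Proof.
move=> oO; rewrite openE => x [p [ap Op] <-].
have ipx : (chart_map a @` chart_dom a) (chart_map a p) by exists p.
have ci : chart_inv a y @[y --> chart_map a p] --> p.
  by rewrite -{2}(chart_mapK ap); exact: chart_inv_cont ipx.
have oI : open_nbhs p (chart_dom a `&` O).
  by split=> //; apply: openI oO; exact: chart_dom_open.
have n1 : \forall y \near chart_map a p, (chart_dom a `&` O) (chart_inv a y).
  exact: ci _ (open_nbhs_nbhs oI).
have n2 : nbhs (chart_map a p) (chart_map a @` chart_dom a).
  by apply: open_nbhs_nbhs; split=> //; exact: chart_img_open.
suff: \forall y \near chart_map a p,
  (chart_map a @` (chart_dom a `&` O)) y by [].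
near=> y.
have [yd yO] : (chart_dom a `&` O) (chart_inv a y) by near: y.
have [q aq qy] : (chart_map a @` chart_dom a) y by near: y.
exists q => //; split=> //; move: yO; rewrite -qy chart_mapK.
Unshelve. all: by end_near. Qed.

Lemma smooth_on_eq O f h : open O -> (forall q, O q -> f q = h q) ->
  smooth_on O f -> smooth_on O h.
Proof.
move=> oO fh sf a aa k; apply: Ck_eq (sf a aa k).
  exact: chart_img_open_sub.
by move=> _ [p [ap Op] <-] /=; rewrite chart_mapK // fh.
Qed.

Lemma smooth_on_sub O V f : V `<=` O -> smooth_on O f -> smooth_on V f.
Proof.
move=> VO sf a aa k; apply: Ck_sub (sf a aa k) => _ [p [ap Vp] <-].
by exists p => //; split=> //; exact: VO.
Qed.

Lemma smooth_on_cst O (a : R) : smooth_on O (fun=> a).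
Proof. by move=> b _ k; exact: Ck_cst. Qed.

Lemma smooth_onD O f h : open O -> smooth_on O f -> smooth_on O h ->
  smooth_on O (fun q => f q + h q).
Proof.
move=> oO sf sh a aa k.
by apply: CkD (sf a aa k) (sh a aa k); exact: chart_img_open_sub.
Qed.

Lemma smooth_onM O f h : open O -> smooth_on O f -> smooth_on O h ->
  smooth_on O (fun q => f q * h q).
Proof.
move=> oO sf sh a aa k.
by apply: CkM (sf a aa k) (sh a aa k); exact: chart_img_open_sub.
Qed.

Lemma indic_setC_on O q : O q -> \1_(~` O) q = 0 :> R.
Proof. by move=> Oq; rewrite indicE memNset //= => /(_ Oq). Qed.

Lemma indic_setC_off O q : ~ O q -> \1_(~` O) q = 1 :> R.
Proof. by move=> nOq; rewrite indicE mem_set. Qed.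

(** Smoothness on [O] ignores the jump across the boundary of [O], so this
    function may be used in the Leibniz rules, with which it localizes
    identities to [O]. *)
Lemma smooth_indic_setC O : open O -> smooth_on O (\1_(~` O) : M -> R).
Proof.
move=> oO; apply: smooth_on_eq (smooth_on_cst O 0) => // q Oq.
by rewrite indic_setC_on.
Qed.

(** If [f] vanishes on [O] then [f = \1_(~` O) * f], and both factors vanish at
    [p]; the general case follows since derivations kill constants. *)
Lemma derivation_locally_cst O p (v : tangent p) (a : R) f :
  open O -> O p -> (forall q, O q -> f q = a) -> v f = 0.
Proof.
move=> oO Op fa.
have [_ vD vM] := asboolP _ (tangent_funP v).
have near0 h b : (forall q, O q -> h q = b) -> smooth_near p h.
  move=> hb; exists O; split=> //.
  by apply: smooth_on_eq (smooth_on_cst O b) => // q /hb.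
have v0 h : (forall q, O q -> h q = 0) -> v h = 0.
  move=> h0; have zh : h = (fun q => \1_(~` O) q * h q).
    apply/funext => q; have [Oq|nOq] := pselect (O q).
      by rewrite h0 // mulr0.
    by rewrite indic_setC_off // mul1r.
  rewrite zh vM ?indic_setC_on ?h0 //; first by rewrite !mul0r addr0.
    by exists O; split=> //; exact: smooth_indic_setC.
  exact: near0 h0.
have s1 : smooth_near p (fun=> 1) by apply: (near0 _ 1).
have v1 : v (fun=> 1) = 0.
  have := vM _ _ s1 s1; rewrite !mul1r => e; lra.
rewrite (_ : f = (fun q => a * 1 + (f q - a))); last first.
  by apply/funext => q; rewrite mulr1 addrC subrK.
rewrite vD //.
  by rewrite v1 v0 ?mulr0 ?addr0 // => q /fa ->; rewrite subrr.
by apply: (near0 _ 0) => q /fa ->; rewrite subrr.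
Qed.

(** * Smooth vector fields on open sets *)

Lemma smooth_vfield_sub O V X : V `<=` O -> smooth_vfield O X ->
  smooth_vfield V X.
Proof.
by move=> VO sX W f oW WV; apply: sX => // q /WV; exact: VO.
Qed.

Lemma smooth_vfield_eq O X Y : (forall q, O q -> X q = Y q) ->
  smooth_vfield O X -> smooth_vfield O Y.
Proof.
move=> XY sX V f oV VO sf; apply: smooth_on_eq (sX V f oV VO sf) => //.
by move=> q Vq; rewrite XY //; exact: VO.
Qed.

Lemma smooth_vfield0 O : smooth_vfield O (fun=> 0).
Proof. by move=> V f _ _ _; exact: smooth_on_cst. Qed.

Lemma smooth_vfieldZD O f X Y : smooth_on O f -> smooth_vfield O X ->
  smooth_vfield O Y -> smooth_vfield O (fun q => f q *: X q + Y q).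
Proof.
move=> sf sX sY V h oV VO sh.
apply: (smooth_onD oV (smooth_onM oV _ (sX V h oV VO sh)) (sY V h oV VO sh)).
exact: smooth_on_sub sf.
Qed.

Lemma smooth_vfieldZ O f X : smooth_on O f -> smooth_vfield O X ->
  smooth_vfield O (fun q => f q *: X q).
Proof.
move=> sf sX.
apply: smooth_vfield_eq (smooth_vfieldZD sf sX (@smooth_vfield0 O)).
by move=> q _; rewrite addr0.
Qed.

Lemma smooth_vfieldD O X Y : smooth_vfield O X ->
  smooth_vfield O Y -> smooth_vfield O (fun q => X q + Y q).
Proof.
move=> sX sY.
apply: smooth_vfield_eq (smooth_vfieldZD (smooth_on_cst O 1) sX sY).
by move=> q _; rewrite scale1r.
Qed.

Lemma smooth_vfieldB O X Y : smooth_vfield O X ->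
  smooth_vfield O Y -> smooth_vfield O (fun q => X q - Y q).
Proof.
move=> sX sY.
apply: smooth_vfield_eq (smooth_vfieldZD (smooth_on_cst O (-1)) sY sX).
by move=> q _; rewrite scaleN1r addrC.
Qed.

Lemma smooth_vfield_sum O (I : Type) (r : seq I) (X : I -> vfield M) :
  (forall i, smooth_vfield O (X i)) ->
  smooth_vfield O (fun q => \sum_(i <- r) X i q).
Proof.
move=> sX; elim: r => [|i r IH].
  by apply: smooth_vfield_eq (@smooth_vfield0 O) => q _; rewrite big_nil.
apply: smooth_vfield_eq (smooth_vfieldD (sX i) IH) => q _.
by rewrite big_cons.
Qed.

End Smooth.

(** * The metric on a tangent space *)

Section MetricAlgebra.
Variables (R : realType) (m : nat) (M : smoothManifold R m).
Variables (g : riemannianMetric M) (p : M).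
Implicit Types (u v w : tangent p).

Lemma metricC u v : g p u v = g p v u.
Proof. exact: rmetric_sym. Qed.

Lemma metricDl u v w : g p (u + v) w = g p u w + g p v w.
Proof. by have := rmetric_linear g 1 u v w; rewrite scale1r mul1r. Qed.

Lemma metric0l w : g p 0 w = 0.
Proof. by have := metricDl 0 0 w; rewrite addr0 => e; lra. Qed.

Lemma metricZl a u w : g p (a *: u) w = a * g p u w.
Proof. by have := rmetric_linear g a u 0 w; rewrite metric0l !addr0. Qed.

Lemma metricBl u v w : g p (u - v) w = g p u w - g p v w.
Proof. by rewrite -scaleN1r metricDl metricZl mulN1r. Qed.

Lemma metricNl u w : g p (- u) w = - g p u w.
Proof. by rewrite -scaleN1r metricZl mulN1r. Qed.

Lemma metricDr u v w : g p u (v + w) = g p u v + g p u w.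
Proof. by rewrite metricC metricDl ![g p _ u]metricC. Qed.

Lemma metricZr a u w : g p u (a *: w) = a * g p u w.
Proof. by rewrite metricC metricZl [g p _ u]metricC. Qed.

Lemma metricBr u v w : g p u (v - w) = g p u v - g p u w.
Proof. by rewrite metricC metricBl ![g p _ u]metricC. Qed.

Lemma metricNr u w : g p u (- w) = - g p u w.
Proof. by rewrite metricC metricNl [g p _ u]metricC. Qed.

Lemma metric_suml (I : Type) (r : seq I) (P : pred I) (F : I -> tangent p) w :
  g p (\sum_(i <- r | P i) F i) w = \sum_(i <- r | P i) g p (F i) w.
Proof.
by elim/big_rec2: _ => [|i x y _ <-]; [exact: metric0l|exact: metricDl].
Qed.

Lemma metric_sumr (I : Type) (r : seq I) (P : pred I) (F : I -> tangent p) w :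
  g p w (\sum_(i <- r | P i) F i) = \sum_(i <- r | P i) g p w (F i).
Proof.
by rewrite metricC metric_suml; apply: eq_bigr => i _; exact: metricC.
Qed.

Lemma metric_ge0 v : 0 <= g p v v.
Proof.
by have [->|/(rmetric_pos g)/ltW //] := eqVneq v 0; rewrite metric0l.
Qed.

Lemma metric_eq0 v : g p v v = 0 -> v = 0.
Proof.
by have [->//|/(rmetric_pos g)] := eqVneq v 0; move=> + e; rewrite e ltxx.
Qed.

End MetricAlgebra.

(** * Connections are local operators *)

Section Connection.
Variables (R : realType) (m : nat) (M : smoothManifold R m).
Variables (nabla : vfield M -> vfield M -> vfield M).
Hypothesis nablaC : is_connection nabla.
Variables (O : set M) (oO : open O).
Implicit Types (X Y Z : vfield M) (q : M).
Local Notation smooth := (smooth_vfield O).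

Lemma connection_smooth X Y : smooth X -> smooth Y -> smooth (nabla X Y).
Proof. by have [+ _ _ _] := nablaC oO; apply. Qed.

Lemma connectionDr X Y Z q : O q -> smooth X -> smooth Y -> smooth Z ->
  nabla X (fun q => Y q + Z q) q = nabla X Y q + nabla X Z q.
Proof. move=> Oq sX sY sZ; have [_ _ D _] := nablaC oO; exact: D. Qed.

Lemma connectionDl X Y Z q : O q -> smooth X -> smooth Y -> smooth Z ->
  nabla (fun q => X q + Y q) Z q = nabla X Z q + nabla Y Z q.
Proof.
move=> Oq sX sY sZ; have [_ D _ _] := nablaC oO.
have := D _ _ _ _ (smooth_on_cst O 1) sX sY sZ q Oq.
rewrite scale1r => <-; congr (nabla _ Z q).
by apply/functional_extensionality_dep => r; rewrite scale1r.
Qed.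

Lemma connectionMr X Y f q : O q -> smooth_on O f -> smooth X -> smooth Y ->
  nabla X (fun q => f q *: Y q) q = X q f *: Y q + f q *: nabla X Y q.
Proof. move=> Oq sf sX sY; have [_ _ _ L] := nablaC oO; exact: L. Qed.

Lemma indic_setC_scale X : (forall q, O q -> X q = 0) ->
  (fun q => \1_(~` O) q *: X q) = X.
Proof.
move=> X0; apply/functional_extensionality_dep => q.
have [Oq|nOq] := pselect (O q); first by rewrite X0 // scaler0.
by rewrite indic_setC_off // scale1r.
Qed.

Lemma smooth_vfield_null X : (forall q, O q -> X q = 0) -> smooth X.
Proof.
by move=> X0; apply: smooth_vfield_eq (@smooth_vfield0 _ _ _ O) => q /X0.
Qed.

(** [Y] equals its product with the indicator of the complement of [O], and both
    terms of the Leibniz rule for that product vanish on [O]. *)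
Lemma connection0r X Y q : O q -> smooth X -> (forall q, O q -> Y q = 0) ->
  nabla X Y q = 0.
Proof.
move=> Oq sX Y0; have sY := smooth_vfield_null Y0.
rewrite -(indic_setC_scale Y0) connectionMr //; last exact: smooth_indic_setC.
by rewrite indic_setC_on // Y0 // scaler0 scale0r addr0.
Qed.

Lemma connection0l X Y q : O q -> smooth Y -> (forall q, O q -> X q = 0) ->
  nabla X Y q = 0.
Proof.
move=> Oq sY X0; have sX := smooth_vfield_null X0.
have [_ D _ _] := nablaC oO.
have := D _ _ _ _ (smooth_indic_setC oO) sX sX sY q Oq.
rewrite indic_setC_on // scale0r add0r.
have -> : (fun q => \1_(~` O) q *: X q + X q) = (fun q => X q + X q).
  apply/functional_extensionality_dep => r; congr (_ + _).
  exact: (congr1 (fun F : vfield M => F r) (indic_setC_scale X0)).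
(* nabla_{X + X} Y = nabla_X Y at q *)
by rewrite connectionDl // => e; apply: (addIr (nabla X Y q)); rewrite e add0r.
Qed.

Lemma connectionBr X Y Z q : O q -> smooth X -> smooth Y -> smooth Z ->
  nabla X (fun q => Y q - Z q) q = nabla X Y q - nabla X Z q.
Proof.
move=> Oq sX sY sZ; apply/eqP; rewrite eq_sym subr_eq; apply/eqP.
rewrite -connectionDr //; last exact: smooth_vfieldB.
by congr (nabla X _ q); apply/functional_extensionality_dep => r; rewrite subrK.
Qed.

Lemma connectionBl X Y Z q : O q -> smooth X -> smooth Y -> smooth Z ->
  nabla (fun q => X q - Y q) Z q = nabla X Z q - nabla Y Z q.
Proof.
move=> Oq sX sY sZ; apply/eqP; rewrite eq_sym subr_eq; apply/eqP.
rewrite -connectionDl //; last exact: smooth_vfieldB.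
by congr (nabla _ Z q); apply/functional_extensionality_dep => r; rewrite subrK.
Qed.

Lemma connection_eqr X Y Z q : O q -> smooth X -> smooth Y ->
  (forall q, O q -> Y q = Z q) -> nabla X Y q = nabla X Z q.
Proof.
move=> Oq sX sY YZ; have sZ := smooth_vfield_eq YZ sY.
apply/eqP; rewrite -subr_eq0 -connectionBr //; apply/eqP.
by apply: connection0r => // r Or; rewrite YZ // subrr.
Qed.

Lemma connection_eql X Y Z q : O q -> smooth X -> smooth Z ->
  (forall q, O q -> X q = Y q) -> nabla X Z q = nabla Y Z q.
Proof.
move=> Oq sX sZ XY; have sY := smooth_vfield_eq XY sX.
apply/eqP; rewrite -subr_eq0 -connectionBl //; apply/eqP.
by apply: connection0l => // r Or; rewrite XY // subrr.
Qed.

End Connection.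

(** * Orthogonal projections onto a framed distribution *)

Section Projection.
Variables (R : realType) (m : nat) (M : smoothManifold R m).
Variables (g : riemannianMetric M).
Implicit Types (X : vfield M) (q : M).

(** Two such vectors [v], [w] both lie in [S q], so [v - w] is orthogonal to
    itself. *)
Lemma proj_unique (S : tangentDistribution M) X q (w : tangent q) :
  S q w -> (forall u, S q u -> g q (X q - w) u = 0) -> Defs.proj g S X q = w.
Proof.
move=> Sw wX; rewrite /Defs.proj.
case: xgetP => [v _ [Sv vX]|/(_ w)]; last by case; split.
apply/subr0_eq/(@metric_eq0 _ _ _ g).
have -> : g q (v - w) (v - w)
    = g q (X q - w) (v - w) - g q (X q - v) (v - w).
  by rewrite -metricBl; congr (g q _ _); rewrite opprB [RHS]addrC addrA subrK.
by rewrite !metricBr !wX // !vX // !subrr.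
Qed.

Variables (n : nat) (D : tangentDistribution M) (O : set M).
Variables (E : 'I_n -> vfield M).
Arguments D : clear implicits.
Hypothesis hE : orthonormal_frame g D O E.

Lemma frame_mem q i : O q -> D q (E i q).
Proof.
move=> Oq; have [[_ bE] _] := hE; rewrite (bE q Oq).2.
exists (fun j => (j == i)%:R).
rewrite (bigD1 i) //= eqxx scale1r big1 ?addr0 //.
by move=> j /negPf ->; rewrite scale0r.
Qed.

Lemma piD_frame X q : O q ->
  piD g D X q = \sum_(i < n) g q (X q) (E i q) *: E i q.
Proof.
move=> Oq; have [[_ bE] oE] := hE; apply: proj_unique.
  by rewrite (bE q Oq).2; exists (fun i => g q (X q) (E i q)).
move=> u; rewrite (bE q Oq).2 => -[a ->]; rewrite metric_sumr big1 // => j _.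
rewrite metricZr metricBl metric_suml (bigD1 j) //= metricZl oE // eqxx.
rewrite mulr1.
rewrite big1 ?addr0 ?subrr ?mulr0 // => i /negPf ij.
by rewrite metricZl oE // ij mulr0.
Qed.

Lemma piD_mem X q : O q -> D q (piD g D X q).
Proof.
move=> Oq; rewrite piD_frame //; have [[_ bE] _] := hE.
by rewrite (bE q Oq).2; exists (fun i => g q (X q) (E i q)).
Qed.

Lemma metric_piD X q (u : tangent q) : O q -> D q u ->
  g q (piD g D X q) u = g q (X q) u.
Proof.
move=> Oq; have [[_ bE] oE] := hE.
rewrite (bE q Oq).2 => -[a ->]; rewrite piD_frame // !metric_sumr.
apply: eq_bigr => j _.
rewrite !metricZr metric_suml (bigD1 j) //= metricZl oE //.
rewrite eqxx mulr1 big1 ?addr0 // => i /negPf ij.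
by rewrite metricZl oE // ij mulr0.
Qed.

Lemma piDperpE X q : O q -> piDperp g D X q = X q - piD g D X q.
Proof.
move=> Oq; apply: proj_unique => [u Du|u uP].
  by rewrite metricBl metric_piD // subrr.
rewrite opprB addrC subrK metricC; apply: uP; exact: piD_mem.
Qed.

Lemma metric_piDperp X q (u : tangent q) : O q -> D q u ->
  g q (piDperp g D X q) u = 0.
Proof. by move=> Oq Du; rewrite piDperpE // metricBl metric_piD // subrr. Qed.

Lemma piDperp_metric X q (w : tangent q) : O q -> perp g D w ->
  g q (piDperp g D X q) w = g q (X q) w.
Proof.
move=> Oq wP; rewrite piDperpE // metricBl [g q (piD g D X q) _]metricC.
by rewrite (wP (piD g D X q)) ?subr0 //; exact: piD_mem.
Qed.

Lemma piD_addD X Y q (a : R) : O q -> D q (Y q) ->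
  piD g D (fun q => X q + a *: Y q) q = piD g D X q + a *: Y q.
Proof.
move=> Oq; have [[_ bE] _] := hE; move=> DY; apply: proj_unique.
  move: DY (piD_mem X Oq); rewrite !(bE q Oq).2 => -[b ->] [d ->].
  exists (fun i => d i + a * b i); rewrite scaler_sumr -big_split /=.
  by apply: eq_bigr => i _; rewrite scalerDl scalerA.
move=> u Du; rewrite opprD addrACA subrr addr0.
by rewrite metricBl metric_piD // subrr.
Qed.

Hypothesis oO : open O.

Lemma piD_smooth X : smooth_vfield O X -> smooth_vfield O (piD g D X).
Proof.
move=> sX; have [[sE _] _] := hE.
pose F q := \sum_(i < n) g q (X q) (E i q) *: E i q.
apply: (smooth_vfield_eq (X := F)) => [q Oq|]; first by rewrite piD_frame.
apply: smooth_vfield_sum => i; apply: smooth_vfieldZ => //.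
exact: rmetric_smooth.
Qed.

Lemma piDperp_smooth X : smooth_vfield O X -> smooth_vfield O (piDperp g D X).
Proof.
move=> sX; apply: smooth_vfield_eq (smooth_vfieldB sX (piD_smooth sX)).
by move=> q Oq; rewrite piDperpE.
Qed.

(** * The Gauss equation of the induced connection *)

Section Gauss.
Variables (nabla : vfield M -> vfield M -> vfield M) (U : vfield M).
Hypotheses (hnabla : levi_civita g nabla) (sU : smooth_vfield O U).
Local Notation smooth := (smooth_vfield O).
Local Notation B := (Bform g nabla D).
Local Notation om := (omega g U).
Let nC : is_connection nabla. Proof. by case: hnabla. Qed.

Lemma lie_nabla X Y q : O q -> smooth X -> smooth Y ->
  lie X Y q = nabla X Y q - nabla Y X q.
Proof. by have [_ T _] := hnabla; move=> Oq sX sY; rewrite (T O). Qed.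

Lemma lie_smooth X Y : smooth X -> smooth Y -> smooth (lie X Y).
Proof.
move=> sX sY; have sN := connection_smooth nC oO.
apply: smooth_vfield_eq (smooth_vfieldB (sN _ _ sX sY) (sN _ _ sY sX)).
by move=> q Oq; rewrite lie_nabla.
Qed.

(** Fields with constant inner product, in particular orthogonal ones, have
    derivatives skew with respect to each other; with [Y] normal and [Z] in [D]
    this turns derivatives of normal fields into values of [B]. *)
Lemma metric_nabla_skew X Y Z a q : O q -> smooth X -> smooth Y -> smooth Z ->
  (forall r, O r -> g r (Y r) (Z r) = a) ->
  g q (nabla X Y q) (Z q) = - g q (nabla X Z q) (Y q).
Proof.
move=> Oq sX sY sZ YZ; have [_ _ C] := hnabla.
have := C O X Y Z oO sX sY sZ q Oq.
rewrite (derivation_locally_cst _ oO Oq YZ) [g q (Y q) _]metricC => e; lra.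
Qed.

Lemma curvature_skew X Y Z q : O q -> smooth X -> smooth Y -> smooth Z ->
  curvature nabla X Y Z q = - curvature nabla Y X Z q.
Proof.
move=> Oq sX sY sZ; rewrite /curvature !opprD !opprK.
have -> : nabla (lie X Y) Z q = - nabla (lie Y X) Z q.
  apply/eqP; rewrite -addr_eq0 -(connectionDl nC oO) //; try exact: lie_smooth.
  apply/eqP; apply: (connection0l nC oO) => // r Or.
  by rewrite !lie_nabla // addrC subrKA subrr.
by rewrite opprK [- _ + _ in RHS]addrC.
Qed.

Lemma metric_Bform X Y q (w : tangent q) : O q -> D q w -> g q (B X Y q) w = 0.
Proof. exact: metric_piDperp. Qed.

Lemma Bform_perp X Y q : O q -> perp g D (B X Y q).
Proof. by move=> Oq u; exact: metric_Bform. Qed.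

Lemma nabla_Bform X Y q (w : tangent q) : O q -> perp g D w ->
  g q (nabla X Y q) w = g q (B X Y q) w.
Proof. by move=> Oq wP; rewrite /Bform piDperp_metric. Qed.

Lemma metric_lie_Bform X Y q (w : tangent q) : O q -> smooth X -> smooth Y ->
  perp g D w -> g q w (lie X Y q) = g q w (B X Y q) - g q w (B Y X q).
Proof.
move=> Oq sX sY wP; rewrite lie_nabla // metricC metricBl !nabla_Bform //.
by rewrite ![g q _ w]metricC.
Qed.

Definition local_section Z := smooth Z /\ forall r, O r -> D r (Z r).

(** This is [alpha1] with [nabla] replaced by the induced connection, because
    [omega (nabla X Z) - omega (B X Z)] is [omega] of the [D]-part of
    [nabla X Z]. *)
Definition alpha1D X Z q := alpha1 g nabla U X Z q + om (B X Z q).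

Lemma nabla_hatDE Y Z r : O r -> local_section Y ->
  nabla_hatD g nabla D U Y Z r
    = nabla Y Z r - B Y Z r + om (Z r) *: Y r.
Proof.
move=> Or [sY DY].
rewrite /nabla_hatD /nabla_hat.
have -> : piD g D (fun p => nabla Y Z p + om (Z p) *: Y p) r
   = piD g D (nabla Y Z) r + om (Z r) *: Y r.
  rewrite -(piD_addD _ _ Or (DY r Or)) /piD /Defs.proj //.
by rewrite /Bform piDperpE // subKr.
Qed.

(** The outer projection disappears against [W], a section of [D].  On [O] the
    inner derivative is [nabla Y Z - B Y Z + omega (Z) Y]; differentiating
    [B Y Z] against [W] gives the product of two values of [B]. *)
Lemma metric_nabla_hatD_twice X Y Z W q : O q ->
  local_section X -> local_section Y -> local_section Z -> local_section W ->
  g q (nabla_hatD g nabla D U X (nabla_hatD g nabla D U Y Z) q) (W q)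
  = g q (nabla X (nabla Y Z) q) (W q) + g q (B Y Z q) (B X W q)
    + X q (fun r => om (Z r)) * g q (Y q) (W q)
    + om (Z q) * g q (nabla X Y q) (W q)
    + (om (nabla Y Z q) - om (B Y Z q) + om (Z q) * om (Y q)) * g q (X q) (W q).
Proof.
move=> Oq [sX DX] hY [sZ DZ] [sW DW]; have [sY DY] := hY.
have sN := connection_smooth nC oO.
have sYZ : smooth (nabla Y Z) by exact: sN.
have sB : smooth (B Y Z) by exact: piDperp_smooth.
have so : smooth_on O (fun r => om (Z r)) by exact: rmetric_smooth.
have sT : smooth (fun r => nabla Y Z r - B Y Z r) by exact: smooth_vfieldB.
have soY : smooth (fun r => om (Z r) *: Y r) by exact: smooth_vfieldZ.
have sR : smooth (fun r => nabla Y Z r - B Y Z r + om (Z r) *: Y r).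
  exact: smooth_vfieldD.
have eR r : O r -> nabla Y Z r - B Y Z r + om (Z r) *: Y r
    = nabla_hatD g nabla D U Y Z r by move=> Or; rewrite nabla_hatDE.
rewrite {1}/nabla_hatD metric_piD //; last exact: DW.
rewrite /nabla_hat -(connection_eqr nC oO Oq sX sR eR) -eR //.
rewrite (connectionDr nC oO) // (connectionBr nC oO) // (connectionMr nC oO) //.
rewrite !(metricDl, metricNl, metricZl).
rewrite (@metric_nabla_skew X (B Y Z) W 0) //; last first.
  by move=> r Or; apply: metric_Bform => //; exact: DW.
rewrite (@nabla_Bform X W) //; last exact: Bform_perp.
rewrite [g q (B X W q) _]metricC /omega !(metricDr, metricNr, metricZr).
ring.
Qed.

(** In the last two terms of [R_hatD] the bracket is split into its [D] and
    normal parts [P] and [N]: as [lie N Z = nabla N Z - nabla Z N], the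
    derivatives along [P] and [N] recombine into the derivative along the
    bracket that occurs in the curvature, and [nabla Z N] contributes
    [- <B Z W, [X, Y]>]. *)
Lemma gauss_hat X Y Z W q : O q ->
  local_section X -> local_section Y -> local_section Z -> local_section W ->
  R4_hatD g nabla D U X Y Z W q
  = g q (curvature nabla X Y Z q) (W q)
    + g q (B Y Z q) (B X W q) - g q (B X Z q) (B Y W q)
    - g q (B Z W q) (B X Y q) + g q (B Z W q) (B Y X q)
    + alpha1D X Z q * g q (Y q) (W q) - alpha1D Y Z q * g q (X q) (W q).
Proof.
move=> Oq hX hY hZ hW.
have [[sX DX] [sY DY]] := (hX, hY); have [[sZ DZ] [sW DW]] := (hZ, hW).
have sL := lie_smooth sX sY.
have sP := piD_smooth sL; have sPp := piDperp_smooth sL.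
have DWq := DW q Oq.
rewrite /R4_hatD /R_hatD !metricBl !metric_nabla_hatD_twice //.
rewrite {1}/nabla_hatD !metric_piD // /nabla_hat lie_nabla //.
rewrite !(metricDl, metricNl, metricZl) metric_piD //.
have eL : g q (nabla (lie X Y) Z q) (W q) =
   g q (nabla (piD g D (lie X Y)) Z q) (W q)
   + g q (nabla (piDperp g D (lie X Y)) Z q) (W q).
  rewrite -metricDl -(connectionDl nC oO) //; congr (g q _ _).
  apply: (connection_eql nC oO) => // r Or.
  by rewrite piDperpE // [RHS]addrC subrK.
have eZ : g q (nabla Z (piDperp g D (lie X Y)) q) (W q)
   = - (g q (B Z W q) (B X Y q) - g q (B Z W q) (B Y X q)).
  rewrite (@metric_nabla_skew Z _ W 0) //; last first.
    by move=> r Or; apply: metric_piDperp => //; exact: DW.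
  rewrite nabla_Bform //; last by move=> u Du; exact: metric_piDperp.
  rewrite metricC piDperp_metric //; last exact: Bform_perp.
  rewrite metricC -metric_lie_Bform //; exact: Bform_perp.
rewrite eZ eL (lie_nabla Oq sX sY) metricBl /alpha1D /alpha1 /nabla_omega.
ring.
Qed.

End Gauss.
End Projection.

(** * The inequality between vectors of an inner product space *)

Section ChenInequality.
Variables (R : realType) (m : nat) (M : smoothManifold R m).
Variables (g : riemannianMetric M) (p : M).
Local Notation "''|' v |^2" := (g p v v) (format "''|' v |^2").

(** The difference of the two sides is half the sum of the [|v i - v j|^2]. *)
Lemma metric_sum_cauchy (I : finType) (P : pred I) (v : I -> tangent p) :
  '|\sum_(i | P i) v i|^2 <= #|P|%:R * \sum_(i | P i) '|v i|^2.
Proof.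
set S := \sum_(i | P i) v i; set Q := \sum_(i | P i) _.
have : 0 <= \sum_(i | P i) \sum_(j | P j) '|v i - v j|^2.
  by do 2 apply: sumr_ge0 => ? _; exact: metric_ge0.
suff -> : \sum_(i | P i) \sum_(j | P j) '|v i - v j|^2
    = 2 * (#|P|%:R * Q - '|S|^2) by move=> H; lra.
transitivity (\sum_(i | P i) (#|P|%:R * '|v i|^2 - 2 * g p (v i) S + Q)).
  apply: eq_bigr => i _.
  rewrite -(sumr_const P) mulr_suml /S metric_sumr mulr_sumr.
  rewrite -sumrB -big_split; apply: eq_bigr => j _ /=.
  by rewrite !(metricBl, metricBr) [g p (v j) (v i)]metricC; ring.
rewrite big_split sumrB /= -!mulr_sumr sumr_const -metric_suml -mulr_natl.
rewrite -/Q -/S.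
ring.
Qed.

Variables (n : nat) (i1 i2 : 'I_n) (b : 'I_n -> 'I_n -> tangent p).
Hypothesis i12 : i1 != i2.

Lemma chen_trace :
  '|\sum_i b i i|^2
    <= (n%:R - 1) * (\sum_i '|b i i|^2 + 2 * g p (b i1 i1) (b i2 i2)).
Proof.
(* the n - 1 vectors obtained by merging the diagonal entries at i1 and i2 *)
pose v i := if i == i1 then b i1 i1 + b i2 i2 else b i i.
have v1 : v i1 = b i1 i1 + b i2 i2 by rewrite /v eqxx.
have vE i : (i != i2) && (i != i1) -> v i = b i i.
  by rewrite /v => /andP[_ /negPf ->].
have cP : #|[pred i | i != i2]|%:R = n%:R - 1 :> R.
  have := cardC1 i2; rewrite card_ord => ->.
  by rewrite -[in RHS](prednK (leq_trans _ (ltn_ord i2))) // -natr1 addrK.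
have := metric_sum_cauchy [pred i | i != i2] v; rewrite cP /=.
have -> : \sum_(i | i != i2) v i = \sum_i b i i.
  rewrite (bigD1 i1) //= v1 (eq_bigr _ vE).
  rewrite [RHS](bigD1 i2) //= [in RHS](bigD1 i1) //=.
  by rewrite addrCA addrA.
suff -> : \sum_(i | i != i2) '|v i|^2
    = \sum_i '|b i i|^2 + 2 * g p (b i1 i1) (b i2 i2) by [].
rewrite (bigD1 i1) //= v1 (eq_bigr (fun i => '|b i i|^2)) => [|i /vE -> //].
rewrite [in RHS](bigD1 i2) //= [in RHS](bigD1 i1) //= !(metricDl, metricDr).
rewrite [g p (b i2 i2) (b i1 i1)]metricC; ring.
Qed.

(** Twice the right side is half the sum of the [|b i j + b j i|^2]: discard all
    of these but the diagonal ones and the two for the pair [i1, i2]. *)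
Lemma symmetric_part_bound :
  2^-1 * \sum_i '|b i i|^2 + g p (b i1 i2) (b i2 i1)
  <= 2^-1 * (\sum_i \sum_j '|b i j|^2)
     + 2^-1 * \sum_i \sum_j g p (b i j) (b j i).
Proof.
pose T i j := '|b i j + b j i|^2.
have T0 i j : 0 <= T i j by exact: metric_ge0.
have T12 : T i2 i1 = T i1 i2 by rewrite /T addrC.
have sumT : \sum_i \sum_j T i j
    = 2 * (\sum_i \sum_j '|b i j|^2)
      + 2 * \sum_i \sum_j g p (b i j) (b j i).
  have -> : \sum_i \sum_j T i j = \sum_i \sum_j '|b i j|^2
      + \sum_i \sum_j '|b j i|^2 + 2 * \sum_i \sum_j g p (b i j) (b j i).
    rewrite mulr_sumr -!big_split; apply: eq_bigr => i _ /=.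
    rewrite mulr_sumr -!big_split; apply: eq_bigr => j _ /=.
    by rewrite /T !(metricDl, metricDr) [g p (b j i) (b i j)]metricC; ring.
  by rewrite [X in _ + X + _]exchange_big /=; ring.
have lbT : 4 * (\sum_i '|b i i|^2) + 2 * T i1 i2 <= \sum_i \sum_j T i j.
  have -> : \sum_i \sum_j T i j
      = \sum_i (T i i + \sum_(j | j != i) T i j).
    by apply: eq_bigr => i _; rewrite (bigD1 i).
  rewrite big_split /= lerD //.
    rewrite mulr_sumr; apply: ler_sum => i _.
    by rewrite /T !(metricDl, metricDr); lra.
  rewrite (bigD1 i1) // (bigD1 i2) /= 1?eq_sym //.
  rewrite (bigD1 i2) /= 1?eq_sym // [X in _ + (X + _)](bigD1 i1) //= T12.
  have S0 i (P : pred 'I_n) : 0 <= \sum_(j | P j) T i j by apply: sumr_ge0.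
  set r1 := (X in T i1 i2 + X); set r2 := (X in _ + (T i1 i2 + X + _)).
  set r3 := (X in _ + (T i1 i2 + _ + X)).
  have : 0 <= r1 by exact: S0.
  have : 0 <= r2 by exact: S0.
  have : 0 <= r3 by apply: sumr_ge0 => i _; exact: S0.
  lra.
have := metric_ge0 g (b i1 i2); have := metric_ge0 g (b i2 i1).
have : 0 <= \sum_i '|b i i|^2 by apply: sumr_ge0 => i _; exact: metric_ge0.
move: lbT; rewrite sumT /T !(metricDl, metricDr).
rewrite [g p (b i2 i1) (b i1 i2)]metricC; lra.
Qed.

Lemma chen_inequality :
  '|\sum_i b i i|^2 / (2 * (n%:R - 1))
  <= 2^-1 * (\sum_i \sum_j '|b i j|^2)
     + 2^-1 * (\sum_i \sum_j g p (b i j) (b j i))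
     + g p (b i1 i1) (b i2 i2) - g p (b i1 i2) (b i2 i1).
Proof.
have n1 : 0 < n%:R - 1 :> R.
  rewrite subr_gt0 ltr1n; case: n i1 i2 i12 => [[]//|[|//]] a a'.
  by rewrite !ord1.
have := chen_trace; rewrite -ler_pdivrMl // => trace_le.
have -> : '|\sum_i b i i|^2 / (2 * (n%:R - 1))
    = 2^-1 * ((n%:R - 1)^-1 * '|\sum_i b i i|^2) by field; lra.
have := symmetric_part_bound; lra.
Qed.

End ChenInequality.

(** * Scalar and sectional curvature in a frame *)

Section FrameCurvature.
Variables (R : realType) (m n : nat) (M : smoothManifold R m).
Variables (g : riemannianMetric M) (nabla : vfield M -> vfield M -> vfield M).
Variables (D : tangentDistribution M) (U : vfield M) (c : R) (O : set M).
Variables (E : 'I_n -> vfield M) (p : M).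
Arguments D : clear implicits.
Hypotheses (hnabla : levi_civita g nabla) (hU : smooth_vfield O U).
Hypotheses (hc : constant_sectional_curvature g nabla c).
Hypotheses (oO : open O) (Op : O p) (hE : orthonormal_frame g D O E).

Local Notation b i j := (Bform g nabla D (E i) (E j) p).
Local Notation A i j := (alpha1D g D nabla U (E i) (E j) p).

Lemma frame_smooth i : smooth_vfield O (E i).
Proof. by have [[sE _] _] := hE. Qed.

Lemma frame_section i : local_section D O (E i).
Proof.
by split=> [|r Or]; [exact: frame_smooth|exact: (frame_mem hE i Or)].
Qed.

Lemma frame_dot i j : g p (E i p) (E j p) = (i == j)%:R.
Proof. by have [_ oE] := hE; exact: oE. Qed.

Lemma frame_curvature i j : i != j ->
  g p (curvature nabla (E i) (E j) (E j) p) (E i p) = c.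
Proof.
move=> ij; have := hc oO (frame_smooth i) (frame_smooth j) Op.
rewrite /sectional_curvature !frame_dot !eqxx (negPf ij).
rewrite mulr1 expr0n subr0 divr1.
apply=> a d e; split.
  have := congr1 (fun w => g p w (E i p)) e.
  rewrite metricDl !metricZl !frame_dot eqxx eq_sym (negPf ij) metric0l.
  by rewrite mulr1 mulr0 addr0.
have := congr1 (fun w => g p w (E j p)) e.
rewrite metricDl !metricZl !frame_dot eqxx (negPf ij) metric0l.
by rewrite mulr1 mulr0 add0r.
Qed.

(** For [i = j] both sides vanish, so that sums over the frame can be taken over
    all pairs of indices. *)
Lemma R4_frame i j :
  R4_hatD g nabla D U (E i) (E j) (E j) (E i) p
  = (1 - (i == j)%:R) * (c - A j j) + g p (b i i) (b j j) - g p (b i j) (b j i)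
    + g p (b j i) (lie (E j) (E i) p).
Proof.
rewrite (gauss_hat hE) //; try exact: frame_section.
rewrite (metric_lie_Bform hE oO hnabla) //; try exact: frame_smooth;
  last exact: (Bform_perp hE).
rewrite !frame_dot !eqxx [j == i]eq_sym [g p (b j i) (b i j)]metricC.
rewrite [g p (b j j) _]metricC.
have [->|ij] := eqVneq i j; last by rewrite frame_curvature //=; ring.
suff -> : curvature nabla (E j) (E j) (E j) p = 0 by rewrite metric0l /=; ring.
have sj := frame_smooth j.
have /eqP := curvature_skew oO hnabla Op sj sj sj.
by rewrite -addr_eq0 -mulr2n -scaler_nat scaler_eq0 pnatr_eq0 /= => /eqP.
Qed.

Lemma R4_frame_swap i j : i != j ->
  R4_hatD g nabla D U (E i) (E j) (E i) (E j) p
  = - c - g p (b i i) (b j j) + g p (b i j) (b j i)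
    - g p (b i j) (lie (E i) (E j) p) + A i i.
Proof.
move=> ij; rewrite (gauss_hat hE) //; try exact: frame_section.
rewrite (metric_lie_Bform hE oO hnabla) //; try exact: frame_smooth;
  last exact: (Bform_perp hE).
rewrite !frame_dot !eqxx (negPf ij) (curvature_skew oO hnabla) //;
  try exact: frame_smooth.
rewrite metricNl frame_curvature 1?eq_sym // [g p (b j i) (b i j)]metricC /=.
ring.
Qed.

Lemma tau_frame : tau_hatD g nabla D U E p =
  2^-1 * (n%:R * (n%:R - 1) * c - (n%:R - 1) * \sum_j A j j
    + g p (\sum_i b i i) (\sum_i b i i) - \sum_i \sum_j g p (b i j) (b j i))
  + AD g nabla D E p.
Proof.
rewrite /tau_hatD /AD -mulrDr; congr (_ * _).
under eq_bigr => i _ do under eq_bigr => j _ do rewrite R4_frame.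
under eq_bigr => i _ do rewrite big_split sumrB big_split /=.
rewrite big_split sumrB big_split /=.
congr (_ + _); congr (_ - _); congr (_ + _).
  rewrite exchange_big /=.
  under eq_bigr => j _ do rewrite -mulr_suml sumrB sumr_const card_ord.
  transitivity (\sum_(j < n) ((n%:R - 1) * c - (n%:R - 1) * A j j)).
    apply: eq_bigr => j _; rewrite (bigD1 j) //= eqxx big1 ?addr0 ?mulrBr //.
    by move=> i /negPf ->.
  by rewrite sumrB sumr_const card_ord -mulr_sumr -[X in X - _]mulr_natr; ring.
rewrite metric_suml; apply: eq_bigr => i _; rewrite metric_sumr //.
Qed.

Lemma sum_alpha1D :
  \sum_j A j j = lambda1 g nabla U E p + omega g U (\sum_i b i i).
Proof. by rewrite big_split /= /omega metric_sumr. Qed.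

Lemma K_frame i j : i != j -> K_hatD g nabla D U (E i) (E j) p
  = c + g p (b i i) (b j j) - g p (b i j) (b j i)
    - OmegaPi g nabla D (E i) (E j) p
    - 2^-1 * tr_alpha1 g nabla U (E i) (E j) p
    - 2^-1 * omega g U (tr_B g nabla D (E i) (E j) p).
Proof.
move=> ij; rewrite /K_hatD R4_frame R4_frame_swap // (negPf ij) /OmegaPi.
have -> : lie (E j) (E i) p = - lie (E i) (E j) p.
  by rewrite !(lie_nabla oO hnabla Op) ?opprB //; exact: frame_smooth.
rewrite /tr_alpha1 /tr_B /omega metricBl metricNr metricDr /alpha1D /omega /=.
by field.
Qed.

Lemma tau_sub_K_le (i j : 'I_n) : (2 < n)%N -> i != j ->
  tau_hatD g nabla D U E p - K_hatD g nabla D U (E i) (E j) p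
  <= (n%:R + 1) * (n%:R - 2) / 2 * c
     - (n%:R - 1) / 2 * lambda1 g nabla U E p
     - n%:R * (n%:R - 1) / 2 * omega g U (Hvec g nabla D E p)
     + 2^-1 * tr_alpha1 g nabla U (E i) (E j) p
     + 2^-1 * omega g U (tr_B g nabla D (E i) (E j) p)
     + AD g nabla D E p
     + OmegaPi g nabla D (E i) (E j) p
     + n%:R ^+ 2 * (n%:R - 2) / (2 * (n%:R - 1))
         * g p (Hvec g nabla D E p) (Hvec g nabla D E p)
     + 2^-1 * normB2 g nabla D E p.
Proof.
move=> n2 ij; have N2 : 2 < n%:R :> R by rewrite ltr_nat.
rewrite tau_frame K_frame // sum_alpha1D /Hvec !(metricZr, metricZl).
have := chen_inequality g (fun i j => b i j) ij.
rewrite -/(normB2 g nabla D E p) /=.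
set h2 := g p (\sum_i _) _; set h := omega g U (\sum_i _) => chen.
have -> : omega g U (n%:R^-1 *: \sum_i b i i) = n%:R^-1 * h.
  exact: metricZr.
have -> : n%:R * (n%:R - 1) / 2 * (n%:R^-1 * h) = (n%:R - 1) / 2 * h.
  by field; lra.
have -> : n%:R ^+ 2 * (n%:R - 2) / (2 * (n%:R - 1))
     * (n%:R^-1 * (n%:R^-1 * h2))
   = 2^-1 * h2 - h2 / (2 * (n%:R - 1)).
  by field; apply/andP; split; lra.
move: chen; set q := h2 / _ => chen.
lra.
Qed.

End FrameCurvature.

(** * The inequality for the scalar and sectional curvatures *)

Unset Implicit Arguments.
Set Strict Implicit.

Theorem theorem3p4 (R : realType) (m n : nat) (M : smoothManifold R m)
    (g : riemannianMetric M) (nabla : vfield M -> vfield M -> vfield M)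
    (D : tangentDistribution M) (U : vfield M) (c : R)
    (hnabla : levi_civita g nabla)
    (hn : (3 <= n)%N)
    (hD : smooth_subbundle n D)
    (hDni : non_integrable D)
    (hU : smooth_vfield setT U)
    (hc : constant_sectional_curvature g nabla c)
    (p : M) (Pi : set (tangent p))
    (hPi : is_plane Pi) (hPiD : Pi `<=` D p)
    (O : set M) (E : 'I_n -> vfield M)
    (hO : open O) (hp : O p)
    (hE : orthonormal_frame g D O E)
    (i1 i2 : 'I_n) (hi1 : i1 = 0%N :> nat) (hi2 : i2 = 1%N :> nat)
    (hEPi : is_basis (tnth [tuple E i1 p; E i2 p]) Pi) :
  tau_hatD g nabla D U E p - K_hatD g nabla D U (E i1) (E i2) p
  <= (n%:R + 1) * (n%:R - 2) / 2 * c
     - (n%:R - 1) / 2 * lambda1 g nabla U E p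
     - n%:R * (n%:R - 1) / 2 * omega g U (Hvec g nabla D E p)
     + 2^-1 * tr_alpha1 g nabla U (E i1) (E i2) p
     + 2^-1 * omega g U (tr_B g nabla D (E i1) (E i2) p)
     + AD g nabla D E p
     + OmegaPi g nabla D (E i1) (E i2) p
     + n%:R ^+ 2 * (n%:R - 2) / (2 * (n%:R - 1))
         * g p (Hvec g nabla D E p) (Hvec g nabla D E p)
     + 2^-1 * normB2 g nabla D E p.
Proof.
apply: (tau_sub_K_le hnabla (smooth_vfield_sub _ hU) hc hO hp hE) => //.
by apply/eqP => /(congr1 (@nat_of_ord n)); rewrite hi1 hi2.
Qed.
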